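(* We have $E^C_{\mathrm{Lip}([0,1])} \sim_B \ell_\infty$.
   Context: $\mathcal{H}^+([0,1])$ is the Polish group of increasing homeomorphisms of $[0,1]$ onto itself, with the supremum metric. $\mathrm{Lip}([0,1]) = \{f \in \mathcal{H}^+([0,1]) : f \text{ and } f^{-1} \text{ are Lipschitz}\}$, a Borel subgroup of $\mathcal{H}^+([0,1])$, equipped with the Borel structure inherited from $\mathcal{H}^+([0,1])$ (so it is a standard Borel space). $E^C_{\mathrm{Lip}([0,1])}$ is the conjugation equivalence relation on $\mathrm{Lip}([0,1])$: $f_1 \, E^C_{\mathrm{Lip}([0,1])} \, f_2$ iff there is $g \in \mathrm{Lip}([0,1])$ with $g \circ f_1 \circ g^{-1} = f_2$. $\ell_\infty$ denotes the equivalence relation on $\mathbb{R}^{\mathbb{N}}$ given by $(x_n)\,\ell_\infty\,(y_n)$ iff $\sup_n |x_n - y_n| < \infty$. For equivalence relations $E, F$ on standard Borel spaces $X, Y$: $E \leq_B F$ means there is a Borel map $f: X \to Y$ with $x E y \iff f(x) F f(y)$ for all $x,y\in X$; $E \sim_B F$ means $E \leq_B F$ and $F \leq_B E$. *)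

(* Defs.v *)
From HB Require Import structures.
From mathcomp Require Import all_boot all_order all_algebra.
From mathcomp Require Import all_classical all_reals all_analysis.
From mathcomp Require Import lra.

Set Implicit Arguments.
Unset Strict Implicit.
Unset Printing Implicit Defensive.

Import Order.TTheory GRing.Theory Num.Theory.
Import numFieldNormedType.Exports.

Local Open Scope classical_set_scope.
Local Open Scope ring_scope.

Section borel_reducibility.
Context d1 d2 (X : measurableType d1) (Y : measurableType d2).

Definition borel_reducible (E : X -> X -> Prop) (F : Y -> Y -> Prop) : Prop :=
  exists f : X -> Y,
    measurable_fun setT f /\ (forall x y, E x y <-> F (f x) (f y)).

End borel_reducibility.

Definition borel_bireducible d1 d2 (X : measurableType d1)
    (Y : measurableType d2) (E : X -> X -> Prop) (F : Y -> Y -> Prop) : Prop :=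
  borel_reducible E F /\ borel_reducible F E.

Definition borel (T : ptopologicalType) := g_sigma_algebraType (@open T).

(* As a `set_type`, it carries the topology induced by that of R. *)
Definition unit_itv (R : realType) := set_type (`[0, 1]%classic : set R).

Record hplus (R : realType) := Hplus {
  hplus_fun :> unit_itv R -> unit_itv R ;
  hplus_incr : forall x y : unit_itv R,
    val x < val y -> val (hplus_fun x) < val (hplus_fun y) ;
  hplus_continuous : continuous hplus_fun ;
  hplus_inverse : exists g : unit_itv R -> unit_itv R,
    [/\ cancel hplus_fun g, cancel g hplus_fun & continuous g] }.

Section hplus_group.
Context (R : realType).
Local Notation I := (unit_itv R).
Local Notation H := (hplus R).

HB.instance Definition _ := gen_eqMixin H.
HB.instance Definition _ := gen_choiceMixin H.

Lemma hplus_ext (f g : H) : (forall x, f x = g x) -> f = g.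
Proof.
case: f g => [f f1 f2 f3] [g g1 g2 g3] /= /funext fg.
move: f1 f2 f3 g1 g2 g3; rewrite fg => *.
by congr Hplus; exact: Prop_irrelevance.
Qed.

Definition hplus_invfun (f : H) : I -> I := sval (cid (hplus_inverse f)).

Lemma hplus_invfunP (f : H) :
  [/\ cancel f (hplus_invfun f), cancel (hplus_invfun f) f &
      continuous (hplus_invfun f)].
Proof. exact: svalP (cid (hplus_inverse f)). Qed.

Lemma hplus_invfun_incr (f : H) (x y : I) :
  val x < val y -> val (hplus_invfun f x) < val (hplus_invfun f y).
Proof.
have [_ gK _] := hplus_invfunP f.
move=> xy; rewrite ltNge le_eqVlt; apply/negP => /orP[/eqP/val_inj e|].
  by move: xy; rewrite -(gK x) -(gK y) e ltxx.
by move/(hplus_incr f); rewrite !gK => /(lt_trans xy); rewrite ltxx.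
Qed.

Definition hplus_inv (f : H) : H.
Proof.
refine (@Hplus R (hplus_invfun f) (@hplus_invfun_incr f) _ _).
- by case: (hplus_invfunP f).
- by exists f; case: (hplus_invfunP f) => *; split => //; exact: hplus_continuous.
Defined.

Definition hplus_one : H.
Proof.
refine (@Hplus R idfun (fun x y xy => xy) _ _).
- by move=> x; exact: cvg_id.
- by exists idfun; split => // x; exact: cvg_id.
Defined.

Definition hplus_mul (f g : H) : H.
Proof.
refine (@Hplus R (f \o g) _ _ _).
- by move=> x y xy; do 2 apply: hplus_incr.
- by move=> x; apply: continuous_comp; exact: hplus_continuous.
- have [fK fK' cf] := hplus_invfunP f; have [gK gK' cg] := hplus_invfunP g.
  exists (hplus_invfun g \o hplus_invfun f); split.
  + exact: can_comp.
  + exact: can_comp.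
  + by move=> x; apply: continuous_comp; [exact: cf|exact: cg].
Defined.

Fact hplus_mulA : associative hplus_mul.
Proof. by move=> f g h; exact: hplus_ext. Qed.
Fact hplus_mul1 : left_id hplus_one hplus_mul.
Proof. by move=> f; exact: hplus_ext. Qed.
Fact hplus_mulr1 : right_id hplus_one hplus_mul.
Proof. by move=> f; exact: hplus_ext. Qed.
Fact hplus_mulV : left_inverse hplus_one hplus_inv hplus_mul.
Proof. by move=> f; apply: hplus_ext => x /=; case: (hplus_invfunP f). Qed.
Fact hplus_mulrV : right_inverse hplus_one hplus_inv hplus_mul.
Proof. by move=> f; apply: hplus_ext => x /=; case: (hplus_invfunP f). Qed.

HB.instance Definition _ :=
  isGroup.Build H hplus_mulA hplus_mul1 hplus_mulr1 hplus_mulV hplus_mulrV.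

End hplus_group.

Section hplus_metric.
Context (R : realType).
Local Notation I := (unit_itv R).
Local Notation H := (hplus R).

Definition sup_dist (f g : H) : R :=
  sup (range (fun t : I => `|val (f t) - val (g t)|)).

Let I0_subproof : (0 : R) \in (`[0, 1]%classic : set R).
Proof. by apply: mem_set; rewrite /= in_itv/= lexx ler01. Qed.

Let I0 : I := exist _ 0 I0_subproof.

Fact sup_dist_has_sup (f g : H) :
  has_sup (range (fun t : I => `|val (f t) - val (g t)|)).
Proof.
split; first by exists `|val (f I0) - val (g I0)|, I0.
exists 1 => _ [t _ <-].
have val01 (s : I) : 0 <= val s <= 1 by have := set_valP s; rewrite /= in_itv.
move: (val01 (f t)) (val01 (g t)); move: (val (f t)) (val (g t)) => a b.
by rewrite ler_norml; lra.
Qed.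

Fact sup_distP (f g : H) t : `|val (f t) - val (g t)| <= sup_dist f g.
Proof. by apply: ub_le_sup; [case: (sup_dist_has_sup f g)|exists t]. Qed.

Fact sup_dist_le (f g : H) (e : R) :
  (forall t, `|val (f t) - val (g t)| <= e) -> sup_dist f g <= e.
Proof.
move=> le_e; apply: ge_sup; first by case: (sup_dist_has_sup f g).
by move=> _ [t _ <-].
Qed.

Fact sup_distxx f : sup_dist f f = 0.
Proof.
apply/eqP; rewrite eq_le; apply/andP; split.
  by apply: sup_dist_le => t; rewrite subrr normr0.
exact: le_trans (normr_ge0 _) (sup_distP f f I0).
Qed.

Fact sup_dist_positivity f g : sup_dist f g = 0 -> f = g.
Proof.
move=> fg0; apply: hplus_ext => t; apply: val_inj; apply/eqP.
by rewrite -subr_eq0 -normr_le0 (le_trans (sup_distP f g t))// fg0.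
Qed.

Fact sup_dist_sym f g : sup_dist f g = sup_dist g f.
Proof.
by congr sup; apply: eq_imagel => t _; rewrite distrC.
Qed.

Fact sup_dist_triangle g f h : sup_dist f h <= sup_dist f g + sup_dist g h.
Proof.
apply: sup_dist_le => t; apply: le_trans (ler_distD (val (g t)) _ _) _.
by rewrite lerD// sup_distP.
Qed.

HB.instance Definition _ := @isMetric.Build R H sup_dist
  sup_distxx sup_dist_positivity sup_dist_sym sup_dist_triangle.
HB.instance Definition _ := isPointed.Build H 1%g.

End hplus_metric.

Section lip.
Context (R : realType).
Local Notation I := (unit_itv R).
Local Notation H := (hplus R).

Definition is_lipschitz (f : I -> I) : Prop :=
  exists k : R, forall x y : I,
    `|val (f x) - val (f y)| <= k * `|val x - val y|.

Definition lip_set : set H := [set f : H | is_lipschitz f /\ is_lipschitz f^-1%g].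

Definition lip_pred : pred H := [pred f | f \in lip_set].

Record lip := Lip { lip_val :> H ; lip_valP : lip_pred lip_val }.

HB.instance Definition _ := [isSub for lip_val].
HB.instance Definition _ := [Choice of lip by <:].

Fact is_lipschitz_comp (f g : I -> I) :
  is_lipschitz f -> is_lipschitz g -> is_lipschitz (f \o g).
Proof.
move=> [k fk] [l gl]; exists (`|k| * l) => x y.
apply: le_trans (fk (g x) (g y)) _.
apply: (@le_trans _ _ (`|k| * `|val (g x) - val (g y)|)).
  by rewrite ler_wpM2r// ler_norm.
by rewrite -mulrA ler_wpM2l.
Qed.

Fact lip_group_closed : group_closed lip_pred.
Proof.
have lip1 : is_lipschitz (1%g : H).
  by exists 1 => x y; rewrite mul1r.
split.
  by apply/mem_set; split; rewrite ?invg1.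
move=> f g /set_mem[f1 f2] /set_mem[g1 g2]; apply/mem_set; split.
  exact: is_lipschitz_comp.
rewrite invgF; exact: is_lipschitz_comp.
Qed.

HB.instance Definition _ :=
  SubChoice_isSubGroup.Build H lip_pred lip lip_group_closed.
HB.instance Definition _ := isPointed.Build lip 1%g.

(* The relative Borel structure: the sets S `&` B with B Borel in H. *)
Definition borel_lip := g_sigma_algebra_preimageType (lip_val : lip -> borel H).

Definition conj_lip (f1 f2 : lip) : Prop :=
  exists g : lip, (g * f1 * g^-1)%g = f2.

End lip.

(* R^N with the product topology. *)
Definition real_seq (R : realType) : Type := {ptws nat -> R}.

HB.instance Definition _ (R : realType) := Pointed.on (real_seq R).
HB.instance Definition _ (R : realType) := Topological.on (real_seq R).

Definition ell_infty (R : realType) (x y : real_seq R) : Prop :=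
  (ereal_sup (range (fun n => `|x n - y n|%:E)) < +oo)%E.

(* Main.v *)
(* Upper bound.  For f, h in Lip let d(f, h) be the least m such that some
   2^m-bi-Lipschitz g satisfies g f = h g.  This is an extended metric whose
   finiteness is conjugacy, and by compactness of the 2^m-bi-Lipschitz maps
   in [0,1]^[0,1] the relations d <= m are closed.  If U runs through a
   countable base of the pointwise topology and k through N, the functions
   f |-> min (d(f, U), k) are thus 1-Lipschitz for d and separate
   d-distant points; the set d(., U) <= m is a union of conjugates of U,
   hence open, so together these functions are a Borel reduction to l_infty.

   Lower bound.  Encode x in R^N by a sequence z_n increasing to 1 with
   1 - z_n = exp (- u_n), where the u_n grow fast and sup |u_n(x) - u_n(y)| is
   finite iff x and y are l_infty-equivalent.  Let f_x(t) be t plus half the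
   distance from t to {z_n}, so that the z_n and 1 are its only fixed points.
   A conjugacy of f_x with f_y preserves the ordered set of fixed points, so
   being bi-Lipschitz at 1 it bounds |u_n(x) - u_n(y)|; conversely the
   piecewise affine map z_n(x) |-> z_n(y) conjugates f_x to f_y. *)

Require Import Defs.
From mathcomp Require Import all_boot all_order all_algebra.
From mathcomp Require Import all_classical all_reals all_analysis.
From mathcomp Require Import lra ring.

Set Implicit Arguments.
Unset Strict Implicit.
Unset Printing Implicit Defensive.

Import Order.TTheory GRing.Theory Num.Theory.
Import numFieldNormedType.Exports.

Local Open Scope classical_set_scope.
Local Open Scope ring_scope.

(** * Bi-Lipschitz maps of the unit interval *)

Section unit_interval.
Context (R : realType).
Local Notation I := (unit_itv R).

Lemma val01 (t : I) : 0 <= val t <= 1.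
Proof. by have := set_valP t; rewrite /= in_itv. Qed.

Fact clamp_subproof (r : R) :
  Num.max 0 (Num.min r 1) \in (`[0, 1]%classic : set R).
Proof.
by apply: mem_set; rewrite /= in_itv/= le_max lexx/= ge_max ler01 ge_min lexx orbT.
Qed.

(** A retraction of the line onto [0,1], so that points of the interval can be given by plain
    reals. *)
Definition clamp (r : R) : I := exist _ (Num.max 0 (Num.min r 1)) (clamp_subproof r).

Lemma clampE (r : R) : 0 <= r <= 1 -> val (clamp r) = r.
Proof. by move=> /andP[r0 r1]; rewrite /= (min_idPl r1) (max_idPr r0). Qed.

Lemma between_val01 (s t : I) (c : R) : val s < c < val t -> 0 <= c <= 1.
Proof.
move=> /andP[sc ct]; have /andP[s0 _] := val01 s; have /andP[_ t1] := val01 t.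
by rewrite (le_trans s0 (ltW sc)) (le_trans (ltW ct) t1).
Qed.
Lemma clamp_dist (r s : R) : `|val (clamp r) - val (clamp s)| <= `|r - s|.
Proof.
have h (a : R) : [\/ a <= 0 /\ val (clamp a) = 0, 0 <= a <= 1 /\ val (clamp a) = a
    | 1 <= a /\ val (clamp a) = 1].
  rewrite /=; case: (leP a 1) => a1; last by rewrite (max_idPr ler01); apply: Or33; rewrite ltW.
  by case: (leP a 0) => a0; [apply: Or31|apply: Or32]; rewrite ?a0 ?a1 ?ltW.
have := ler_norm (r - s); have := ler_norm (s - r); rewrite (distrC s).
by case: (h r) => -[r1 ->]; case: (h s) => -[s1 ->]; rewrite ler_norml; lra.
Qed.

Lemma lipschitz_continuous (phi : I -> I) : is_lipschitz phi -> continuous phi.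
Proof.
move=> [k phik]; apply: continuous_comp_initial => x.
have k0 : 0 < `|k| + 1 by rewrite ltr_pwDr.
have FF : Filter (nbhs (x : I)) := nbhs_filter _.
have cv : set_val y @[y --> x] --> (set_val x : R) by exact: initial_continuous.
apply/(@cvgrPdist_lt _ _ _ (nbhs (x : I)) FF) => e e0 /=.
move: cv => /(@cvgrPdist_lt _ _ _ (nbhs (x : I)) FF)/(_ _ (divr_gt0 e0 k0)).
apply: (@filterS I (nbhs x)) => y.
rewrite ltr_pdivlMr// => xy.
apply: le_lt_trans (phik x y) _; apply: le_lt_trans xy.
rewrite mulrC ler_wpM2l// (le_trans (ler_norm k))//; lra.
Qed.

(** Working with ordered pairs and without absolute values builds in monotonicity, and makes the
    condition pass to the inverse with the same constant. *)
Definition bilip (K : R) (phi : I -> I) := 1 <= K /\ forall a b : I, val a <= val b ->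
  val (phi b) - val (phi a) <= K * (val b - val a) /\
  val b - val a <= K * (val (phi b) - val (phi a)).

Lemma bilip_lt K (phi : I -> I) x y : bilip K phi ->
  (val (phi x) < val (phi y)) = (val x < val y).
Proof.
move=> phiK; have [K1 Kphi] := phiK.
case: (ltP (val x) (val y)) => xy; last first.
  apply/negbTE; rewrite -leNgt; have [_ h] := Kphi y x xy.
  by rewrite -subr_ge0 -(@pmulr_rge0 _ K) ?(le_trans _ h) ?subr_ge0//; lra.
have [_ h] := Kphi x y (ltW xy).
by rewrite -subr_gt0 -(@pmulr_rgt0 _ K) ?(lt_le_trans _ h) ?subr_gt0//; lra.
Qed.

Lemma bilip_dist K (phi : I -> I) x y : bilip K phi ->
  `|val (phi x) - val (phi y)| <= K * `|val x - val y|.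
Proof.
move=> phiK; have [K1 Kphi] := phiK.
wlog xy : x y / val x <= val y => [hw|].
  by case: (leP (val x) (val y)) => [/hw//|/ltW/hw]; rewrite distrC (distrC (val y)).
have [h1 h2] := Kphi _ _ xy.
have fxy : val (phi x) <= val (phi y).
  by rewrite -subr_ge0 -(@pmulr_rge0 _ K) ?(le_trans _ h2) ?subr_ge0//; lra.
by rewrite distrC (distrC (val x)) !ger0_norm ?subr_ge0.
Qed.

Lemma bilip_surj K (phi : I -> I) : bilip K phi ->
  phi (clamp 0) = clamp 0 -> phi (clamp 1) = clamp 1 ->
  forall y, exists x, phi x = y.
Proof.
move=> phiK phi0 phi1 y.
have [K1 Kphi] := phiK.
(* Composing with [clamp] extends [phi] to the whole line, where the intermediate value theorem
   applies. *)
pose F (r : R) : R := val (phi (clamp r)).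
have cF : {within `[0, 1], continuous F}.
  apply: continuous_subspaceT => x; apply/cvgrPdist_lt => e e0 /=.
  near=> z; apply: le_lt_trans (bilip_dist _ _ phiK) _.
  have : `|x - z| < e / K.
    by near: z; apply: cvgr_dist_lt => //; rewrite divr_gt0//; lra.
  rewrite ltr_pdivlMr; last lra.
  by apply: le_lt_trans; rewrite mulrC ler_wpM2r ?clamp_dist//; lra.
have [c c01 Fc] : exists2 c, c \in `[0, 1] & F c = val y.
  apply: IVT => //; rewrite /F phi0 phi1 !clampE ?lexx ?ler01//.
  by rewrite (min_idPl _)// (max_idPr _)// val01.
by exists (clamp c); apply: val_inj.
Unshelve. all: by end_near. Qed.

(** Every map given by a formula or as a limit below enters [lip] through this lemma. Fixed
    endpoints yield surjectivity, and the inverse is again K-bi-Lipschitz, hence continuous. *)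
Lemma bilip_lip K (phi : I -> I) : bilip K phi ->
  phi (clamp 0) = clamp 0 -> phi (clamp 1) = clamp 1 ->
  exists g : lip R, forall t, g t = phi t.
Proof.
move=> phiK phi0 phi1; have [K1 Kphi] := phiK.
have phi_surj := bilip_surj phiK phi0 phi1.
have phi_inj x y : phi x = phi y -> x = y.
  move=> xy; apply: val_inj; apply/eqP; rewrite eq_le !leNgt.
  by rewrite -(bilip_lt x y phiK) -(bilip_lt y x phiK) xy ltxx.
pose psi y := sval (cid (phi_surj y)).
have psiK : cancel psi phi by move=> y; exact: svalP (cid (phi_surj y)).
have phiKi : cancel phi psi by move=> x; exact/phi_inj/psiK.
have Kpsi : bilip K psi.
  split=> // a b ab; have := Kphi (psi a) (psi b).
  rewrite !psiK; case=> //.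
  by rewrite leNgt -(bilip_lt _ _ phiK) !psiK -leNgt.
have lipB (f : I -> I) : bilip K f -> is_lipschitz f.
  by exists K => x y; exact: bilip_dist.
have phi_incr x y : val x < val y -> val (phi x) < val (phi y).
  by rewrite (bilip_lt _ _ phiK).
have phi_inv : exists g : I -> I, [/\ cancel phi g, cancel g phi & continuous g].
  by exists psi; split=> //; exact/lipschitz_continuous/lipB.
pose f := Hplus phi_incr (lipschitz_continuous (lipB _ phiK)) phi_inv.
have Lf : lip_pred f.
  apply/mem_set; split; first exact: lipB phiK.
  have -> : hplus_fun f^-1%g = psi; last exact: (lipB _ Kpsi).
  apply/funext => x; apply: phi_inj; rewrite psiK.
  by have [_ + _] := hplus_invfunP f; exact.
by exists (Lip Lf).
Qed.

Lemma hplus_lt (f : hplus R) x y : (val (f x) < val (f y)) = (val x < val y).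
Proof.
apply/idP/idP; last exact: hplus_incr.
apply: contraLR; rewrite -!leNgt le_eqVlt => /orP[/eqP/val_inj->//|].
by move=> /(hplus_incr f)/ltW.
Qed.

Lemma hplus_le (f : hplus R) x y : (val (f x) <= val (f y)) = (val x <= val y).
Proof. by rewrite !leNgt hplus_lt. Qed.

Lemma hplus_surj (f : hplus R) y : exists x, f x = y.
Proof. by exists (hplus_invfun f y); have [_ + _] := hplus_invfunP f; exact. Qed.

Lemma hplus_inj (f : hplus R) : injective f.
Proof. by have [+ _ _] := hplus_invfunP f; exact: can_inj. Qed.

Lemma hplus0 (f : hplus R) : f (clamp 0) = clamp 0.
Proof.
have [x fx] := hplus_surj f (clamp 0).
have : val (f (clamp 0)) <= val (f x).
  by rewrite hplus_le clampE ?lexx ?ler01//; have /andP[] := val01 x.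
rewrite fx => f0; apply: val_inj; apply/eqP; rewrite eq_le f0.
by rewrite [val (clamp 0)]clampE ?lexx ?ler01//; have /andP[] := val01 (f (clamp 0)).
Qed.

Lemma hplus1 (f : hplus R) : f (clamp 1) = clamp 1.
Proof.
have [x fx] := hplus_surj f (clamp 1).
have : val (f x) <= val (f (clamp 1)).
  by rewrite hplus_le clampE ?lexx ?ler01//; have /andP[] := val01 x.
rewrite fx => f1; apply: val_inj; apply/eqP; rewrite eq_le f1 andbT.
by rewrite [val (clamp 1)]clampE ?lexx ?ler01//; have /andP[] := val01 (f (clamp 1)).
Qed.

Lemma lip_invK (g : lip R) t : g ((g^-1)%g t) = t.
Proof.
have : (g * g^-1)%g t = t by rewrite mulgV.
by rewrite valM.
Qed.

Lemma lip_bilip (g : lip R) : exists n : nat, bilip (2 ^+ n) g.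
Proof.
have /set_mem[[k gk] [l gl]] := lip_valP g.
have [n kn] : exists n : nat, `|k| + `|l| <= 2 ^+ n.
  exists (Num.bound (`|k| + `|l|)).
  apply: ltW; apply: lt_le_trans (archi_boundP (addr_ge0 _ _)) _ => //.
  by rewrite -natrX ler_nat ltnW// ltn_expl.
exists n; split=> [|a b ab]; first by rewrite -natrX ler1n expn_gt0.
have gab : val (g a) <= val (g b) by rewrite hplus_le.
have := gk a b; have := gl (g a) (g b).
have gVK x : (lip_val g)^-1%g (g x) = x.
  by have [+ _ _] := hplus_invfunP g; exact.
rewrite (gVK a) (gVK b) (distrC (val a)) (distrC (val (g a))) !ger0_norm ?subr_ge0// => h1 h2.
have k1 : k <= 2 ^+ n by rewrite (le_trans _ kn)// (le_trans (ler_norm _))// lerDl.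
have l1 : l <= 2 ^+ n by rewrite (le_trans _ kn)// (le_trans (ler_norm _))// lerDr.
split; [apply: le_trans h2 _|apply: le_trans h1 _]; rewrite ler_wpM2r// subr_ge0//.
Qed.

Lemma conj_lipP (f1 f2 : lip R) :
  conj_lip f1 f2 <-> exists g : lip R, forall t, g (f1 t) = f2 (g t).
Proof.
have lipM (a b : lip R) t : (a * b)%g t = a (b t) by rewrite valM.
split=> -[g gP]; exists g.
  move=> t; rewrite -gP -[in RHS]lipM -mulgA mulVg mulg1 lipM//.
apply: (mulIg g); rewrite -mulgA mulVg mulg1; apply: val_inj; apply: hplus_ext => t.
by rewrite !lipM.
Qed.

End unit_interval.

(** * Reduction of conjugacy to l_infty *)

Section conjugacy_levels.
Context (R : realType).
Local Notation I := (unit_itv R).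
Local Notation H := (hplus R).

Lemma ell_inftyP (x y : real_seq R) :
  ell_infty x y <-> exists M : R, forall n, `|x n - y n| <= M.
Proof.
split=> [xy|[M xyM]].
  exists (fine (ereal_sup (range (fun n => `|x n - y n|%:E)))) => n.
  have h : (`|x n - y n|%:E <= ereal_sup (range (fun n => `|x n - y n|%:E)))%E.
    by apply: ereal_sup_ubound; exists n.
  rewrite -lee_fin fineK// fin_numE; apply/andP; split.
    by apply: contraTneq h => ->.
  by rewrite lt_eqF.
apply: (@le_lt_trans _ _ M%:E); last exact: ltry.
by apply: ge_ereal_sup => _ [n _ <-]; rewrite lee_fin.
Qed.

(** Rational arguments and bounds make [seq cond] countable, so that [pickle] can enumerate the
    basic open sets. The boolean selects a lower or an upper bound. *)
Definition cond := (bool * rat * rat)%type.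

Definition holds (p : cond) (f : H) : Prop :=
  let v := val (f (clamp (ratr p.1.2))) in
  if p.1.1 then ratr p.2 < v else v < ratr p.2.

Definition basic (s : seq cond) : set H := [set f | forall p, p \in s -> holds p f].

(** The relation d(f, h) <= m; accordingly [near_basic s m] is the set d(., [basic s]) <= m. With
    powers of 2 as constants, composing conjugacies adds exponents. *)
Definition conj_by (m : nat) (f h : H) : Prop :=
  exists g : lip R, bilip (2 ^+ m) g /\ forall t, g (f t) = h (g t).

Definition near_basic (s : seq cond) (m : nat) : set (lip R) :=
  [set f | exists h : lip R, basic s h /\ conj_by m f h].

Lemma near_basic_self s m (f : lip R) : basic s f -> near_basic s m f.
Proof.
move=> sf; exists f; split=> //; exists 1%g; split=> //.
split=> [|a b ab]; first by rewrite -natrX ler1n expn_gt0.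
have K1 : 1 <= (2:R) ^+ m by rewrite -natrX ler1n expn_gt0.
by split; rewrite ler_peMl// subr_ge0.
Qed.

Lemma bilip_comp K L (f g : I -> I) :
  bilip K f -> bilip L g -> bilip (K * L) (f \o g).
Proof.
move=> fK [L1 gL]; have [K1 fKP] := fK; split; first by rewrite mulr_ege1.
move=> a b ab /=; have [g1 g2] := gL _ _ ab.
have gab : val (g a) <= val (g b).
  by rewrite -subr_ge0 -(@pmulr_rge0 _ L) ?(le_trans _ g2) ?subr_ge0//; lra.
have [f1 f2] := fKP _ _ gab; split.
  by apply: le_trans f1 _; rewrite -mulrA ler_wpM2l//; lra.
by apply: le_trans g2 _; rewrite (mulrC K) -mulrA ler_wpM2l//; lra.
Qed.

Lemma bilip_inv K (g : lip R) : bilip K g -> bilip K (g^-1)%g.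
Proof.
move=> [K1 gK]; split=> // a b ab; have := gK ((g^-1)%g a) ((g^-1)%g b).
rewrite !lip_invK; case=> //.
by rewrite -(hplus_le g) !lip_invK.
Qed.

Lemma conj_by_comp m n (f g h : H) :
  conj_by m f g -> conj_by n g h -> conj_by (m + n) f h.
Proof.
move=> [a [aK afg]] [b [bK bgh]]; exists (b * a)%g; split.
  by rewrite addnC exprD valM; exact: bilip_comp.
by move=> t; rewrite valM /= afg bgh.
Qed.

Lemma conj_by_sym m (f g : H) : conj_by m f g -> conj_by m g f.
Proof.
move=> [a [aK afg]]; exists (a^-1)%g; split; first exact: bilip_inv.
by move=> t; apply: (@hplus_inj _ a); rewrite lip_invK afg lip_invK.
Qed.

Lemma conj_by_exists (f h : lip R) : conj_lip f h <-> exists m, conj_by m f h.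
Proof.
split=> [/conj_lipP[g gP]|[m [g [_ gP]]]]; last by apply/conj_lipP; exists g.
by have [m gm] := lip_bilip g; exists m, g.
Qed.

(** The triangle inequality for d, from which [level] inherits its Lipschitz property. *)
Lemma near_basic_conj s m n (f h : lip R) :
  conj_by n f h -> near_basic s m f -> near_basic s (m + n) h.
Proof.
move=> fh [k [sk fk]]; exists k; split=> //; rewrite addnC.
exact: conj_by_comp (conj_by_sym fh) fk.
Qed.

End conjugacy_levels.

(** * Compactness of bi-Lipschitz maps and closedness of d <= m *)

Section compactness.
Context (R : realType).
Local Notation I := (unit_itv R).
Local Notation H := (hplus R).

Lemma ptws_eval_continuous (t : I) :
  continuous (fun G : {ptws I -> R} => G t).
Proof. exact: (@proj_continuous I (fun=> R) t). Qed.

Lemma closed_fun_le (T : topologicalType) (F : T -> R) (c : R) :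
  continuous F -> closed [set x | F x <= c].
Proof. by move=> cF; apply: preimage_closed (@closed_le R c) => x _; exact: cF. Qed.

Lemma closed_fun_ge (T : topologicalType) (F : T -> R) (c : R) :
  continuous F -> closed [set x | c <= F x].
Proof. by move=> cF; apply: preimage_closed (@closed_ge R c) => x _; exact: cF. Qed.

Lemma continuous_subM (T : topologicalType) (F G : T -> R) (c : R) :
  continuous F -> continuous G -> continuous (fun x => c * (F x - G x)).
Proof.
move=> cF cG x; apply: cvgM; first exact: cvg_cst.
by apply: cvgB; [exact: cF|exact: cG].
Qed.

Lemma closed_forall (T : topologicalType) (J : Type) (P : J -> T -> Prop) :
  (forall j, closed [set x | P j x]) -> closed [set x | forall j, P j x].
Proof.
move=> cP.
have -> : [set x | forall j, P j x] = \bigcap_j [set x | P j x].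
  by apply/seteqP; split=> [x Px j _|x Px j]; [exact: Px|exact: (Px j)].
exact: closed_bigI.
Qed.

(** A cluster point in A of the filter generated by the sets [A] ∩ [f j] lies in each closed [f j].
    The index [j0] ensures that A belongs to that filter. *)
Lemma compact_finI (T : topologicalType) (A : set T) (J : choiceType) (D : set J)
    (f : J -> set T) (j0 : J) : compact A -> D j0 ->
  (forall j, D j -> closed (f j)) -> finI D (fun j => A `&` f j) ->
  \bigcap_(j in D) (A `&` f j) !=set0.
Proof.
move=> cA Dj0 cf finIf; have FF := finI_filter finIf.
have [|p [Ap clp]] := cA _ FF.
  exists (A `&` f j0); [exact: finI_from1|exact: subIsetl].
exists p => j Dj; split=> //; apply: cf => // B; apply: clp.
exists (A `&` f j); [exact: finI_from1|exact: subIsetr].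
Qed.

(** Only weak inequalities between evaluations occur, so the set is pointwise closed. For G with
    values in [0,1] the last two force G to fix 0 and 1. *)
Definition bilip_graph (K : R) : set {ptws I -> R} :=
  [set G | forall ab : {ab : I * I | val ab.1 <= val ab.2},
    G (val ab).2 - G (val ab).1 <= K * (val (val ab).2 - val (val ab).1)] `&`
  [set G | forall ab : {ab : I * I | val ab.1 <= val ab.2},
    val (val ab).2 - val (val ab).1 <= K * (G (val ab).2 - G (val ab).1)] `&`
  ([set G | G (clamp 0) <= 0] `&` [set G | 1 <= G (clamp 1)]).

Lemma closed_bilip_graph K : closed (bilip_graph K).
Proof.
have ev := ptws_eval_continuous.
apply: closedI; apply: closedI.
- apply: closed_forall => ab; under eq_set do rewrite -[leLHS]mul1r.
  have h := continuous_subM (c := 1) (ev (val ab).2) (ev (val ab).1).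
  exact: (closed_fun_le (c := K * _) h).
- apply: closed_forall => ab.
  have h := continuous_subM (c := K) (ev (val ab).2) (ev (val ab).1).
  exact: (closed_fun_ge h).
- exact: closed_fun_le (ev _).
- exact: closed_fun_ge (ev _).
Qed.

(* What [holds p h] says, through the monotonicity of h, about a map G with
   G y = h G, weakened so as to mention only values of G at fixed arguments and
   hence to be pointwise closed in G. *)
Definition cond_graph (y : H) (p : cond) : set {ptws I -> R} := [set G |
  forall t : I, if p.1.1 then G t <= val (clamp (ratr p.1.2)) \/ ratr p.2 <= G (y t)
                else val (clamp (ratr p.1.2)) <= G t \/ G (y t) <= ratr p.2].

Lemma closed_cond_graph y p : closed (cond_graph y p).
Proof.
apply: closed_forall => t; have ev := ptws_eval_continuous.
by case: p.1.1; apply: closedU; first [exact: closed_fun_le (ev _)|exact: closed_fun_ge (ev _)].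
Qed.

Lemma rat_between (a b : R) : a < b -> exists c : rat, a < ratr c < b.
Proof. by case/rat_in_itvoo=> c; rewrite in_itv; exists c. Qed.

(** Take c between x p and s, then q between p and the preimage of c. This gives a condition true of
    x that, through [cond_graph], rules out a map G with G t = p and G (y t) = s. *)
Lemma hplus_rat_above (x : H) (p s : I) : val (x p) < val s -> exists q c : rat,
  [/\ val p < val (clamp (ratr q)), val (x (clamp (ratr q))) < ratr c & ratr c < val s].
Proof.
move=> xs; have [c /andP[xc cs]] := rat_between xs.
have [z xz] := hplus_surj x (clamp (ratr c)).
have xzE : val (x z) = ratr c by rewrite xz clampE// (@between_val01 _ (x p) s)// xc.
have pz : val p < val z by rewrite -(hplus_lt x) xzE.
have [q /andP[pq qz]] := rat_between pz.
have q01 : 0 <= (ratr q : R) <= 1 by rewrite (@between_val01 _ p z)// pq.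
by exists q, c; rewrite -xzE hplus_lt xzE !(clampE q01).
Qed.

Lemma hplus_rat_below (x : H) (p s : I) : val s < val (x p) -> exists q c : rat,
  [/\ val (clamp (ratr q)) < val p, ratr c < val (x (clamp (ratr q))) & val s < ratr c].
Proof.
move=> xs; have [c /andP[sc cx]] := rat_between xs.
have [z xz] := hplus_surj x (clamp (ratr c)).
have xzE : val (x z) = ratr c by rewrite xz clampE// (@between_val01 _ s (x p))// sc.
have zp : val z < val p by rewrite -(hplus_lt x) xzE.
have [q /andP[zq qp]] := rat_between zp.
have q01 : 0 <= (ratr q : R) <= 1 by rewrite (@between_val01 _ z p)// zq.
by exists q, c; rewrite -xzE hplus_lt xzE !(clampE q01).
Qed.

(** Finitely many conditions true of x hold for some h with d(y, h) <= m, and the conjugating g then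
    lies in the corresponding closed sets [cond_graph y p]. By Tychonoff some G lies in all of them
    at once, and this G conjugates y to x. *)
Lemma conj_by_closed (m : nat) (y x : lip R) :
  (forall s, basic s x -> near_basic s m y) -> conj_by m y x.
Proof.
move=> yx; set K : R := 2 ^+ m.
have K1 : 1 <= K by rewrite /K -natrX ler1n expn_gt0.
have cA : compact [set G : {ptws I -> R} | forall t, `[0, 1]%classic (G t)].
  exact: (@tychonoff I (fun=> R) (fun=> `[0, 1]%classic) (fun=> @segment_compact R 0 1)).
(* The index [None] carries the bi-Lipschitz requirement, the other indices the conditions true of
   x. *)
pose C (p : option cond) := if p is Some p then cond_graph y p else bilip_graph K.
pose D : set (option cond) := [set p | if p is Some p then holds p x else True].
have [G GP] : \bigcap_(p in D)
    ([set G : {ptws I -> R} | forall t, `[0, 1]%classic (G t)] `&` C p) !=set0.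
  apply: (compact_finI (j0 := None) cA) => //.
    by move=> -[p|] _ /=; [exact: closed_cond_graph|exact: closed_bilip_graph].
  move=> D' D'D.
  have [h [sh [g [gK gP]]]] : near_basic (pmap id (finmap.enum_fset D')) m y.
    apply: yx => p; rewrite mem_pmap map_id => /D'D.
    by rewrite inE.
  exists (fun t => val (g t)) => p pD'; split.
    by move=> t /=; rewrite in_itv/= val01.
  case: p pD' => [p|] pD' /=; last first.
    split; split; [| |by rewrite /= hplus0 clampE ?lexx ?ler01|
      by rewrite /= hplus1 clampE ?lexx ?ler01]; move=> -[[a b] /= ab];
      by have [] := proj2 gK a b ab.
  move=> t; have /sh : p \in pmap id (finmap.enum_fset D') by rewrite mem_pmap map_id.
  rewrite /holds gP; set q := clamp _; case: p.1.1 => cq.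
    case: (leP (val (g t)) (val q)) => tq; [by left|right].
    by apply: ltW; apply: lt_trans cq _; rewrite hplus_lt.
  case: (leP (val q) (val (g t))) => tq; [by left|right].
  by apply: ltW; apply: lt_trans cq; rewrite hplus_lt.
have G01 t : 0 <= G t <= 1.
  by have [/(_ t)/= + _] := GP None Logic.I; rewrite in_itv.
have [_ [[GK1 GK2] [G0 G1]]] := GP None Logic.I.
pose phi t := clamp (G t).
have phiE t : val (phi t) = G t by rewrite /phi clampE.
have phiK : bilip K phi.
  split=> // a b ab; rewrite !phiE; split.
    exact: (GK1 (exist _ (a, b) ab)).
  exact: (GK2 (exist _ (a, b) ab)).
have phi0 : phi (clamp 0) = clamp 0.
  apply: val_inj; rewrite phiE clampE ?lexx ?ler01//.
  by apply/eqP; rewrite eq_le G0; have /andP[] := G01 (clamp 0).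
have phi1 : phi (clamp 1) = clamp 1.
  apply: val_inj; rewrite phiE clampE ?lexx ?ler01//.
  by apply/eqP; rewrite eq_le G1 andbT; have /andP[] := G01 (clamp 1).
have [g gE] := bilip_lip phiK phi0 phi1; exists g; split.
  by split=> // a b ab; rewrite !gE; exact: (proj2 phiK).
(* If either inequality between G (y t) and x (G t) failed, a rational condition true of x would
   witness the failure, against the choice of G. *)
move=> t; rewrite !gE; apply: val_inj; apply/eqP; rewrite eq_le !leNgt.
apply/andP; split; apply/negP.
  move=> /hplus_rat_above[q [c [tq xq cG]]].
  have [] : val (clamp (ratr q)) <= G t \/ G (y t) <= ratr c.
    exact: (proj2 (GP (Some (false, q, c)) xq) t).
  - by rewrite -phiE leNgt tq.
  - by rewrite -phiE leNgt cG.
move=> /hplus_rat_below[q [c [qt xq Gc]]].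
have [] : G t <= val (clamp (ratr q)) \/ ratr c <= G (y t).
  exact: (proj2 (GP (Some (true, q, c)) xq) t).
- by rewrite -phiE leNgt qt.
- by rewrite -phiE leNgt Gc.
Qed.

End compactness.

(** * The Borel map into l_infty *)

Section lip_to_ell_infty.
Context (R : realType).
Local Notation I := (unit_itv R).
Local Notation H := (hplus R).

Lemma open_eval_comp (g : lip R) (t : I) (B : set R) :
  open B -> open [set f : H | B (val (g (f t)))].
Proof.
move=> oB; apply: (open_comp (f := fun f : H => val (g (f t)))) => // f _.
have [K [K1 gK]] : exists K : R, bilip K g.
  by have [n gn] := lip_bilip g; exists (2 ^+ n).
have FF : Filter (nbhs (f : H)) := nbhs_filter f.
apply/(@cvgrPdist_lt _ _ _ (nbhs (f : H)) FF) => e e0.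
have : nbhs f (ball f (e / K)) by apply: nbhsx_ballx; rewrite divr_gt0//; lra.
apply: (@filterS H (nbhs f)) => h.
move=> fh; apply: le_lt_trans (bilip_dist _ _ (conj K1 gK)) _.
move: fh; rewrite -metricType_numDomainType.ball_mdistE /= ltr_pdivlMr; last lra.
apply: le_lt_trans; rewrite mulrC ler_wpM2r//; first lra.
exact: sup_distP.
Qed.

(** The set is the union, over all 2^m-bi-Lipschitz g, of the preimages of [basic s] under
    conjugation by g. The union is uncountable, but each member is open. *)
Lemma open_near_basic s m : exists V : set H,
  open V /\ near_basic s m = [set f : lip R | V f].
Proof.
exists (\bigcup_(g in [set g : lip R | bilip (2 ^+ m) g])
  [set f : H | basic s (lip_val g * f * (lip_val g)^-1)%g]); split.
  apply: bigcup_open => g _.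
  elim: s => [|p s IH].
    rewrite (_ : [set _ | _] = setT); first exact: openT.
    by apply/seteqP; split=> // f _ p.
  rewrite (_ : [set _ | _] =
      [set f : H | holds p (lip_val g * f * (lip_val g)^-1)%g] `&`
      [set f : H | basic s (lip_val g * f * (lip_val g)^-1)%g]).
    apply: openI IH; rewrite /holds; case: p.1.1.
      exact: (@open_eval_comp g ((lip_val g)^-1%g (clamp (ratr p.1.2)))
        [set r | ratr p.2 < r] (@open_gt R _)).
    exact: (@open_eval_comp g ((lip_val g)^-1%g (clamp (ratr p.1.2)))
        [set r | r < ratr p.2] (@open_lt R _)).
  apply/seteqP; split=> f.
    by move=> ps; split=> [|q qs]; apply: ps; rewrite inE ?eqxx// qs orbT.
  by move=> [fp fs] q; rewrite inE => /orP[/eqP->//|/fs].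
apply/seteqP; split=> f.
  move=> [h [sh [g [gK gP]]]]; exists g => //=.
  have -> // : (lip_val g * f * (lip_val g)^-1)%g = h.
  apply: hplus_ext => t; have [_ gVK _] := hplus_invfunP g.
  by rewrite /= gP gVK.
move=> [g gK sg]; exists (g * f * g^-1)%g; split; first by rewrite !valM gmulfV.
exists g; split=> // t.
by have [gK' _ _] := hplus_invfunP g; rewrite !valM gmulfV /= gK'.
Qed.

Lemma measurable_near_basic s m :
  measurable (near_basic s m : set (borel_lip R)).
Proof.
have [V [oV ->]] := open_near_basic s m.
exists V; last by rewrite setTI.
exact: sub_sigma_algebra.
Qed.

(* min (d(f, basic s), k), as the number of m < k with d(f, basic s) > m *)
Definition level (i : nat) (f : lip R) : nat :=
  if unpickle i is Some (s, k) then (\sum_(0 <= m < k) ~~ `[< near_basic s m f >])%N else 0%N.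

Lemma level_conj i n (f h : lip R) : conj_by n f h -> (level i h <= level i f + n)%N.
Proof.
move=> fh; rewrite /level; case: unpickle => [[s k]|//].
(* The sum for h is lengthened to k + n terms. The first n contribute at most n, and by
   [near_basic_conj] the term m + n for h is at most the term m for f. *)
apply: (@leq_trans (\sum_(0 <= m < k + n) ~~ `[< near_basic s m h >])%N).
  by rewrite [leqRHS](@big_cat_nat _ _ _ k)//= leq_addr.
rewrite addnC (@big_cat_nat _ _ _ n)//= ?leq_addr// addnC leq_add//.
  rewrite -{1}[n]add0n (addnC n k) big_addn addnK.
  apply: leq_sum => m _; case: (asboolP (near_basic s m f)) => [fs|]; last by case: asboolP.
  by rewrite asboolT//; exact: near_basic_conj fh fs.
apply: (@leq_trans (\sum_(0 <= m < n) 1)%N); last by rewrite sum_nat_const_nat subn0 muln1.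
by apply: leq_sum => m _; exact: leq_b1.
Qed.

Lemma level_separates n (f h : lip R) : ~ conj_by n h f ->
  exists i, level i f = 0%N /\ (n < level i h)%N.
Proof.
move=> fh.
have [s /not_implyP[sf sh]] : exists s, ~ (basic s f -> near_basic s n h).
  by apply/existsNP => sP; apply: fh; exact: conj_by_closed.
(* With cutoff n + 1 every term m <= n counts at h, because nearness at m would imply nearness at n;
   so the level there is n + 1. *)
exists (pickle (s, n.+1)); rewrite /level pickleK; split.
  by rewrite big1// => m _; rewrite asboolT//; exact: near_basic_self.
rewrite big_mkord (eq_bigr (fun=> 1%N)) ?sum1_card ?card_ord// => m _.
rewrite asboolF// => sm; apply: sh.
have -> : n = (m + (n - m))%N by rewrite subnKC// -ltnS.
apply: near_basic_conj sm.
exists 1%g; split=> //; split=> [|a b ab]; first by rewrite -natrX ler1n expn_gt0.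
have K1 : 1 <= (2:R) ^+ (n - m) by rewrite -natrX ler1n expn_gt0.
by split; rewrite ler_peMl// subr_ge0.
Qed.

Lemma measurable_level i (v : nat) :
  measurable ([set f | level i f = v] : set (borel_lip R)).
Proof.
rewrite /level; case: unpickle => [[s k]|]; last first.
  case: v => [|v]; [rewrite (_ : [set _ | _] = setT)|rewrite (_ : [set _ | _] = set0)] => //;
    by apply/seteqP; split.
elim: k v => [|k IH] v.
  case: v => [|v]; [rewrite (_ : [set _ | _] = setT)|rewrite (_ : [set _ | _] = set0)] => //;
    by apply/seteqP; split=> // f; rewrite /= big_geq.
pose N (f : lip R) := (\sum_(0 <= m < k) ~~ `[< near_basic s m f >])%N.
pose prev := if v is v'.+1 then [set f | N f = v'] else set0.
rewrite (_ : [set _ | _] =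
  ([set f | N f = v] `&` near_basic s k) `|` (prev `\` near_basic s k)).
  apply: measurableU.
    by apply: measurableI; [exact: IH|exact: measurable_near_basic].
  apply: measurableD; last exact: measurable_near_basic.
  by rewrite /prev; case: (v) => [|v']; [exact: measurable0|exact: IH].
apply/seteqP; split=> f /=; rewrite big_nat_recr//= -/(N f) /prev.
  case: (asboolP (near_basic s k f)) => fs; rewrite ?addn0 ?addn1 => <-; first by left.
  by right.
case: (asboolP (near_basic s k f)) => fs; rewrite ?addn0 ?addn1 => -[[]//|[]//].
by case: (v) => [//|v'] /= ->.
Qed.

Definition levels (f : lip R) : real_seq R := fun i => (level i f)%:R.

Lemma measurable_levels :
  @measurable_fun _ _ (borel_lip R) (borel (real_seq R)) setT levels.
Proof.
apply: (@measurability _ _ (borel_lip R) (borel (real_seq R)) setT levels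
  (@open (real_seq R))) => // _ [W oW <-].
rewrite setTI.
(* The levels are integers, so every open W pulls back to a countable union of
   sets on which finitely many levels are prescribed. *)
pose cyl (v : seq nat) : set (lip R) :=
  \bigcap_(i in [set i | (i < size v)%N]) [set f | level i f = nth 0%N v i].
rewrite (_ : _ @^-1` _ = \bigcup_v
    (if `[< cyl v `<=` levels @^-1` W >] then cyl v else set0)).
  apply: countable_bigcupT_measurable; first exact: countableP.
  move=> v; case: ifP => _; last exact: measurable0.
  by apply: bigcap_measurableType => i _; exact: measurable_level.
apply/seteqP; split=> f; last first.
  by move=> [v _]; case: asboolP => // vW /vW.
(* Otherwise there are [h n] outside W sharing the first n levels of f. Their level sequences
   converge pointwise to that of f, although W is open. *)
move=> fW; apply: contrapT => nf.
have /choice[h hP] : forall n, exists h : lip R,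
    (forall i, (i < n)%N -> level i h = level i f) /\ ~ W (levels h).
  move=> n; have [h [hv hW]] : exists h, cyl (mkseq (level^~ f) n) h /\ ~ W (levels h).
    apply: contrapT => nh; apply: nf; exists (mkseq (level^~ f) n) => //.
    rewrite asboolT; first by move=> i /=; rewrite size_mkseq => i_n; rewrite nth_mkseq.
    by move=> h hv; apply: contrapT => hW; apply: nh; exists h.
  exists h; split=> // i i_n.
  by have := hv i; rewrite /= size_mkseq nth_mkseq//; exact.
have hf : (fun n => levels (h n)) @ \oo --> (levels f : {ptws nat -> R}).
  apply/cvg_sup => i U [V] [[B] oB <-] Bf BU.
  apply: filterS BU _; exists i.+1 => // n /= i_n.
  by rewrite /levels (hP n).1.
have : nbhs (levels f : {ptws nat -> R}) W by exact: open_nbhs_nbhs.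
by move=> /hf[n _ /(_ n (leqnn n))]; exact: (hP n).2.
Qed.

Lemma lip_reducible_ell_infty :
  @borel_reducible _ _ (borel_lip R) (borel (real_seq R)) (@conj_lip R) (@ell_infty R).
Proof.
exists levels; split; first exact: measurable_levels.
move=> f h; rewrite ell_inftyP conj_by_exists; split=> [[n fh]|[M fhM]].
  exists n%:R => i; rewrite /levels ler_distl -natrD ler_nat level_conj//=.
    rewrite lerBlDr -natrD ler_nat level_conj//; exact: conj_by_sym.
  exact: conj_by_sym.
have M0 : 0 <= M by apply: le_trans (fhM 0%N).
exists (Num.bound M); apply: contrapT => nfh.
have [i [h0 fi]] := level_separates nfh.
have := fhM i; rewrite /levels h0 subr0 normr_nat; apply/negP; rewrite -ltNge.
apply: lt_trans (archi_boundP M0) _; rewrite ltr_nat//.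
Qed.

End lip_to_ell_infty.

(** * Reduction of l_infty to conjugacy *)

Section zigzag.
Context (R : realType).
Local Notation I := (unit_itv R).

(** Here [w n] is the distance 1 - z_n. Halving makes each gap [w n - w n.+1] comparable to [w n],
    and bounds all such sequences by the same powers of 1/2, which serves the continuity of
    [encode]. *)
Definition decays (w : nat -> R) :=
  [/\ w 0%N = 1, forall n, 0 < w n & forall n, w n.+1 <= w n / 2].

Lemma decays_le w n : decays w -> w n <= 2^-1 ^+ n.
Proof.
case=> w0 _ wS; elim: n => [|n IH]; first by rewrite w0.
by rewrite exprS; have := wS n; lra.
Qed.

Lemma decays_lt1 w n : decays w -> w n.+1 < w n.
Proof. by case=> _ /(_ n) + /(_ n); lra. Qed.

Lemma decays_homo w m n : decays w -> (m <= n)%N -> w n <= w m.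
Proof.
move=> dw; elim: n => [|n IH]; first by rewrite leqn0 => /eqP->.
rewrite leq_eqVlt => /orP[/eqP->//|/IH]; apply: le_trans.
exact/ltW/decays_lt1.
Qed.

Lemma half_lt (e : R) : 0 < e -> exists N, (2^-1 : R) ^+ N < e.
Proof.
move=> e0; exists (Num.bound e^-1).
rewrite exprVn invf_plt ?posrE ?exprn_gt0//.
apply: lt_trans (archi_boundP _) _; first by rewrite invr_ge0 ltW.
by rewrite -natrX ltr_nat ltn_expl.
Qed.

Lemma decays_cvg0 w : decays w -> w @ \oo --> (0 : R).
Proof.
move=> dw; have [_ w0 _] := dw; apply/cvgrPdist_lt => e e0.
have [N Ne] := half_lt e0; exists N => // n /= Nn.
rewrite sub0r normrN gtr0_norm//; apply: le_lt_trans Ne.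
exact: le_trans (decays_homo dw Nn) (decays_le _ dw).
Qed.

Lemma decays_itv w (t : R) : decays w -> 0 <= t < 1 ->
  exists n, 1 - w n <= t < 1 - w n.+1.
Proof.
move=> dw /andP[t0 t1]; have [w0 _ _] := dw.
have ex : exists n, t < 1 - w n.
  have [N Ne] := @half_lt (1 - t) ltac:(lra); exists N.
  by have := decays_le N dw; lra.
case: (ex_minnP ex) => -[|n] tn min; first by move: tn; rewrite w0; lra.
by exists n; rewrite tn andbT leNgt; apply/negP => /min; rewrite ltnn.
Qed.

Definition tent (a b t : R) : R := Num.max 0 (Num.min (t - a) (b - t)).

Lemma tentP (a b t : R) : [\/ tent a b t = 0 /\ (t - a <= 0 \/ b - t <= 0),
  tent a b t = t - a /\ 0 <= t - a <= b - t | tent a b t = b - t /\ 0 <= b - t <= t - a].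
Proof.
rewrite /tent; case: (leP (t - a) (b - t)) => h.
  case: (leP 0 (t - a)) => h'; first by apply: Or32.
  by apply: Or31; split=> //; left; apply: ltW.
case: (leP 0 (b - t)) => h'; first by apply: Or33; rewrite ltW.
by apply: Or31; split=> //; right; apply: ltW.
Qed.

Lemma tent_dist a b a' b' t e : `|a - a'| <= e -> `|b - b'| <= e ->
  tent a b t <= tent a' b' t + e.
Proof.
rewrite !ler_norml => /andP[? ?] /andP[? ?].
by case: (tentP a b t) => -[->]; case: (tentP a' b' t) => -[->]; lra.
Qed.

Lemma tent_lip a b t s : tent a b t <= tent a b s + `|t - s|.
Proof.
have := ler_norm (t - s); have := ler_norm (s - t); rewrite (distrC s).
by case: (tentP a b t) => -[->]; case: (tentP a b s) => -[->]; lra.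
Qed.

(** On [0,1] this is the distance to {z_n}. As a supremum of tents it inherits termwise the
    Lipschitz estimate in t and the stability under uniform changes of w. *)
Definition bump (w : nat -> R) (t : R) : R :=
  sup (range (fun n => tent (1 - w n) (1 - w n.+1) t)).

Lemma tent_bound w n (t : R) : decays w -> 0 <= t <= 1 ->
  0 <= tent (1 - w n) (1 - w n.+1) t <= 1 - t.
Proof.
case=> _ /(_ n.+1) w0 _ t01.
by case: (tentP (1 - w n) (1 - w n.+1) t) => -[->]; lra.
Qed.

Lemma tent_le_bump w n (t : R) : decays w -> 0 <= t <= 1 ->
  tent (1 - w n) (1 - w n.+1) t <= bump w t.
Proof.
move=> dw t01; apply: ub_le_sup; last by exists n.
by exists (1 - t) => _ [m _ <-]; have /andP[] := tent_bound m dw t01.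
Qed.

Lemma bump_le w t c : (forall n, tent (1 - w n) (1 - w n.+1) t <= c) -> bump w t <= c.
Proof.
move=> tc; apply: ge_sup; first by exists (tent (1 - w 0%N) (1 - w 1%N) t), 0%N.
by move=> _ [n _ <-].
Qed.

Lemma bump_bound w (t : R) : decays w -> 0 <= t <= 1 -> 0 <= bump w t <= 1 - t.
Proof.
move=> dw t01; apply/andP; split.
  by apply: le_trans (tent_le_bump 0 dw t01); have /andP[] := tent_bound 0 dw t01.
by apply: bump_le => n; have /andP[] := tent_bound n dw t01.
Qed.

Lemma bump_lip w (t s : R) : decays w -> 0 <= s <= 1 -> bump w t <= bump w s + `|t - s|.
Proof.
move=> dw s01; apply: bump_le => n; apply: le_trans (tent_lip _ _ _ s) _.
by rewrite lerD2r tent_le_bump.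
Qed.

Lemma bump_dist w v (t e : R) : decays v -> 0 <= t <= 1 -> (forall n, `|w n - v n| <= e) ->
  bump w t <= bump v t + e.
Proof.
move=> dv t01 wv; apply: bump_le => n.
apply: le_trans (@tent_dist _ _ (1 - v n) (1 - v n.+1) _ e _ _) _.
- by have := wv n; rewrite distrC; congr (`|_| <= _); ring.
- by have := wv n.+1; rewrite distrC; congr (`|_| <= _); ring.
- by rewrite lerD2r tent_le_bump.
Qed.

(** On this interval all tents other than the n-th vanish. *)
Lemma bump_itv w n (t : R) : decays w -> 1 - w n <= t <= 1 - w n.+1 ->
  bump w t = Num.min (t - (1 - w n)) (1 - w n.+1 - t).
Proof.
move=> dw tn; have [w0 wp _] := dw.
have wn1 : w n <= 1 by rewrite -w0; exact: decays_homo.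
have t01 : 0 <= t <= 1 by have := wp n.+1; lra.
have -> : Num.min (t - (1 - w n)) (1 - w n.+1 - t) = tent (1 - w n) (1 - w n.+1) t.
  by rewrite /tent max_r// le_min; lra.
apply/eqP; rewrite eq_le tent_le_bump// andbT; apply: bump_le => m.
have /andP[p0 _] := tent_bound n dw t01.
case: (ltngtP m n) => [mn|nm|->//].
  have := decays_homo dw mn.
  by case: (tentP (1 - w m) (1 - w m.+1) t) => -[->]; lra.
have := decays_homo dw nm.
by case: (tentP (1 - w m) (1 - w m.+1) t) => -[->]; lra.
Qed.

Lemma bump1 w : decays w -> bump w 1 = 0.
Proof.
move=> dw; have /andP[b0] := bump_bound dw (t := 1) ltac:(lra).
by rewrite subrr => b1; apply/eqP; rewrite eq_le b0 b1.
Qed.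

Lemma bump_eq0 w (t : R) : decays w -> 0 <= t < 1 -> bump w t = 0 <-> exists n, t = 1 - w n.
Proof.
move=> dw t01; split=> [bt|[n ->]].
  have [n tn] := decays_itv dw t01; exists n.
  move: bt; rewrite (bump_itv (n := n) dw); last lra.
  by rewrite /Order.min; case: ifP; lra.
rewrite (bump_itv (n := n) dw); have := decays_lt1 n dw; last lra.
by move=> h; rewrite subrr min_l//; lra.
Qed.

Lemma zigzag_exists w : decays w ->
  exists f : lip R, forall t, val (f t) = val t + bump w (val t) / 2.
Proof.
move=> dw; pose phi (t : I) : I := clamp (val t + bump w (val t) / 2).
have phiE t : val (phi t) = val t + bump w (val t) / 2.
  by rewrite clampE//; have := bump_bound dw (val01 t); have := val01 t; lra.
(* As [bump w] is 1-Lipschitz, adding half of it multiplies increments by a factor between 1/2 and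
   3/2. *)
have phiK : bilip 2 phi.
  split=> [|a b ab]; first lra.
  have := bump_lip (val b) dw (val01 a); have := bump_lip (val a) dw (val01 b).
  by rewrite distrC !phiE ger0_norm ?subr_ge0//; lra.
have c0 : val (clamp (0 : R)) = 0 by rewrite clampE; lra.
have c1 : val (clamp (1 : R)) = 1 by rewrite clampE; lra.
have [||f fE] := @bilip_lip R 2 phi phiK.
- apply: val_inj; rewrite phiE c0 (bump_eq0 dw _).2 ?mul0r ?addr0//; first lra.
  by exists 0%N; case: dw => ->; rewrite subrr.
- by apply: val_inj; rewrite phiE c1 bump1// mul0r addr0.
by exists f => t; rewrite fE.
Qed.

Definition zigzag w (dw : decays w) : lip R := sval (cid (zigzag_exists dw)).

Lemma zigzagE w (dw : decays w) t : val (zigzag dw t) = val t + bump w (val t) / 2.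
Proof. exact: (svalP (cid (zigzag_exists dw))). Qed.

Lemma zigzag_fixed w (dw : decays w) t : val t < 1 ->
  zigzag dw t = t <-> exists n, val t = 1 - w n.
Proof.
move=> t1; have /andP[t0 _] := val01 t.
rewrite -(bump_eq0 dw); last by rewrite t0.
split=> [h|h]; first by have := zigzagE dw t; rewrite h; lra.
by apply: val_inj; rewrite zigzagE h mul0r addr0.
Qed.

(* By induction g moves the n-th fixed point of [zigzag dw] at least as far as
   the n-th fixed point of [zigzag dv]; then use that g is 2^k-bi-Lipschitz at 1. *)
Lemma zigzag_conj_le w v (dw : decays w) (dv : decays v) :
  conj_lip (zigzag dw) (zigzag dv) -> exists K, 0 < K /\ forall n, w n <= K * v n.
Proof.
move=> /conj_lipP[g gP]; have [k [K1 gK]] := lip_bilip g.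
exists (2 ^+ k); split; first lra.
move=> n; have [w0 wp _] := dw; have [v0 vp _] := dv.
have z01 m : 0 <= 1 - w m <= 1.
  by have := decays_homo dw (leq0n m); have := wp m; rewrite w0; lra.
have gz m : 1 - v m <= val (g (clamp (1 - w m))).
  elim: m => [|m IH]; first by rewrite v0 subrr; have /andP[] := val01 (g (clamp (1 - w 0%N))).
  (* A conjugacy sends fixed points to fixed points, so the image is some 1 - v j; strict
     monotonicity then forces j > m. *)
  have [j gj] : exists j, val (g (clamp (1 - w m.+1))) = 1 - v j.
    apply/(zigzag_fixed dv).
      rewrite -[ltRHS](@clampE R); last lra.
      by rewrite -(hplus1 g) hplus_lt !clampE//; [have := wp m.+1; lra|lra].
    rewrite -gP; congr (hplus_fun _ _); apply/(zigzag_fixed dw).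
      by rewrite clampE//; have := wp m.+1; lra.
    by exists m.+1; rewrite clampE.
  have : val (g (clamp (1 - w m))) < val (g (clamp (1 - w m.+1))).
    by rewrite hplus_lt !clampE//; have := decays_lt1 m dw; lra.
  rewrite gj => /(le_lt_trans IH) vjm.
  have mj : (m < j)%N.
    by rewrite ltnNge; apply/negP => /(decays_homo dv); lra.
  by have := decays_homo dv mj; lra.
have [] := gK (clamp (1 - w n)) (clamp 1).
  by rewrite !clampE//; have := wp n; lra.
rewrite hplus1 [val (clamp 1)]clampE ?(clampE (z01 n))//; last lra.
move=> _ h; have -> : w n = 1 - (1 - w n) by ring.
apply: le_trans h _; by rewrite ler_wpM2l//; have := gz n; lra.
Qed.

End zigzag.

(** * The piecewise affine conjugacy between two zigzags *)

Section piecewise_linear.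
Context (R : realType).
Local Notation I := (unit_itv R).
Context (w v : nat -> R) (K : R).
Context (dw : decays w) (dv : decays v) (K0 : 0 < K).
Context (wv : forall n, w n <= K * v n) (vw : forall n, v n <= K * w n).

(** For t >= 0, [step n t] is the length of the part of [1 - w n, 1 - w n.+1] lying below t. Hence G
    integrates the slopes from 0 to t, and Lipschitz bounds can be proved term by term. *)
Let slope n : R := (v n - v n.+1) / (w n - w n.+1).
Let step n (t : R) : R := Num.min t (1 - w n.+1) - Num.min t (1 - w n).
Let psum N (t : R) : R := \sum_(0 <= n < N) slope n * step n t.
Let G (t : R) : R := limn (psum ^~ t).

Let wgap n : w n / 2 <= w n - w n.+1 <= w n.
Proof. by have [_ /(_ n.+1) ? /(_ n) ?] := dw; lra. Qed.

Let vgap n : v n / 2 <= v n - v n.+1 <= v n.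
Proof. by have [_ /(_ n.+1) ? /(_ n) ?] := dv; lra. Qed.

Let wn0 n : 0 < w n. Proof. by case: dw. Qed.
Let vn0 n : 0 < v n. Proof. by case: dv. Qed.

(** Each gap lies between half the corresponding tail and the whole tail, so the slope is within a
    factor 2 of v n / w n, which lies between 1 / K and K. *)
Let slope_bound n : 1 <= 2 * K * slope n /\ slope n <= 2 * K.
Proof.
have w0 := wn0 n; have wg := wgap n; have vg := vgap n.
have := wv n; have := vw n.
rewrite /slope ler_pdivrMr; last lra.
rewrite mulrA ler_pdivlMr; last lra.
by move=> h1 h2; split; nra.
Qed.

Let slope0 n : 0 < slope n.
Proof. by have := wn0 n; have := vn0 n; have := wgap n; have := vgap n => *; apply: divr_gt0; lra. Qed.

Let step_homo n (s t : R) : s <= t -> step n s <= step n t.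
Proof.
move=> st; rewrite /step; have := wgap n; have := wn0 n.
by case: (leP s (1 - w n.+1)); case: (leP s (1 - w n)); case: (leP t (1 - w n.+1));
  case: (leP t (1 - w n)); lra.
Qed.

Let step_sum N (t : R) : 0 <= t -> \sum_(0 <= n < N) step n t = Num.min t (1 - w N).
Proof.
move=> t0; rewrite telescope_sumr//; have [-> _ _] := dw.
by rewrite subrr (min_r t0) subr0.
Qed.

Let step0 n : step n 0 = 0.
Proof.
rewrite /step !min_l ?subrr// subr_ge0; have [w0 _ _] := dw;
  by rewrite -w0 decays_homo.
Qed.

(** The slope bounds are applied termwise to the nonnegative increments of the steps, whose sum
    telescopes. *)
Let psum_diff N (s t : R) : 0 <= s <= t ->
  psum N t - psum N s <= 2 * K * (Num.min t (1 - w N) - Num.min s (1 - w N)) /\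
  Num.min t (1 - w N) - Num.min s (1 - w N) <= 2 * K * (psum N t - psum N s).
Proof.
move=> st; rewrite -!step_sum; [|lra..].
rewrite /psum -!sumrB !mulr_sumr; split; apply: ler_sum => n _; rewrite -mulrBr.
  have := @step_homo n s t ltac:(lra); have [_ ?] := slope_bound n => ?.
  by rewrite ler_wpM2r//; lra.
rewrite mulrA ler_peMl//; have := @step_homo n s t ltac:(lra); have [] := slope_bound n; lra.
Qed.

Let psum0 N : psum N 0 = 0.
Proof. by apply: big1 => n _; rewrite step0 mulr0. Qed.

Let psum_cvg (t : R) : 0 <= t <= 1 -> psum ^~ t @ \oo --> G t.
Proof.
move=> t01; apply: nondecreasing_is_cvgn.
  apply/nondecreasing_seqP => n; rewrite /psum big_nat_recr//= lerDl mulr_ge0//.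
    exact/ltW/slope0.
  by rewrite -(step0 n) step_homo//; lra.
exists (2 * K) => _ [N _ <-]; have [h _] := @psum_diff N 0 t ltac:(lra).
rewrite psum0 subr0 in h; apply: le_trans h _.
rewrite ger_pMr ?mulr_gt0//.
by have [w0 _ _] := dw; have := decays_homo dw (leq0n N); have := wn0 N; rewrite w0 => ? ?;
  case: (leP t (1 - w N)); case: (leP 0 (1 - w N)); lra.
Qed.

Let min_cvg (t : R) : 0 <= t <= 1 -> Num.min t (1 - w N) @[N --> \oo] --> t.
Proof.
move=> t01; apply/cvgrPdist_lt => e e0.
have := decays_cvg0 dw => /cvgrPdist_lt/(_ e e0); apply: filterS => N.
rewrite sub0r normrN (gtr0_norm (wn0 N)) => we.
by rewrite ltr_norml; have := wn0 N; case: (leP t (1 - w N)); lra.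
Qed.

Let G_bilip (s t : R) : 0 <= s -> s <= t -> t <= 1 ->
  G t - G s <= 2 * K * (t - s) /\ t - s <= 2 * K * (G t - G s).
Proof.
move=> s0 st t1.
have cG : psum N t - psum N s @[N --> \oo] --> G t - G s.
  by apply: cvgB; apply: psum_cvg; lra.
have cm : Num.min t (1 - w N) - Num.min s (1 - w N) @[N --> \oo] --> t - s.
  by apply: cvgB; apply: min_cvg; lra.
have h N := @psum_diff N s t ltac:(lra).
split.
  apply: (ler_cvg_to cG (cvgM (cvg_cst (2 * K)) cm)); apply: nearW => N; exact: (h N).1.
apply: (ler_cvg_to cm (cvgM (cvg_cst (2 * K)) cG)); apply: nearW => N; exact: (h N).2.
Qed.

Let psum_ge N (t : R) : 1 - w N <= t -> psum N t = 1 - v N.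
Proof.
have [v0 _ _] := dv; have [w0 _ _] := dw.
elim: N => [|N IH] tN; first by rewrite /psum big_geq// v0 subrr.
have := wgap N; have := wn0 N => ? ?.
rewrite /psum big_nat_recr//= -/(psum N t) IH; last lra.
rewrite /step !min_r; [|lra..].
rewrite /slope; field; lra.
Qed.

Let G_itv n (t : R) : 1 - w n <= t <= 1 - w n.+1 -> G t = 1 - v n + slope n * (t - (1 - w n)).
Proof.
(* All steps after the n-th vanish at t, so the partial sums are constant from n + 1 on. *)
move=> tn; apply: lim_near_cst => //; exists n.+1 => // N /= nN.
rewrite -(subnKC nN); elim: (N - n.+1)%N => [|k IH].
  rewrite addn0 /psum big_nat_recr//= -/(psum n t) psum_ge; last lra.
  by rewrite /step min_l ?min_r//; lra.
rewrite addnS /psum big_nat_recr//= -/(psum _ t) IH /step !min_l ?subrr ?mulr0 ?addr0//.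
  by have := decays_homo dw (leq_addr k n.+1); lra.
by have := @decays_homo R w n.+1 (n.+1 + k).+1 dw ltac:(rewrite -addnS leq_addr//); lra.
Qed.

Let G1 : G 1 = 1.
Proof.
apply/cvg_lim => //; have -> : psum ^~ 1 = fun N => 1 - v N.
  by apply/funext => N; rewrite psum_ge//; have := wn0 N; lra.
rewrite -[X in _ --> X]subr0; apply: cvgB; [exact: cvg_cst|exact: decays_cvg0].
Qed.

Let G0 : G 0 = 0.
Proof.
apply/cvg_lim => //; have -> : psum ^~ 0 = fun N => 0.
  by apply/funext => N; exact: psum0.
exact: cvg_cst.
Qed.

(** On each interval between consecutive fixed points G is affine and maps endpoints to endpoints.
    It therefore multiplies the distance to the nearest fixed point by its slope, and so commutes
    with moving by half that distance. *)
Lemma zigzag_conj : conj_lip (zigzag dw) (zigzag dv).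
Proof.
have K1 : 1 <= 2 * K.
  have := wv 0; have [-> _ _] := dw; have [-> _ _] := dv; lra.
have G01 (t : R) : 0 <= t <= 1 -> 0 <= G t <= 1.
  move=> t01; have [_ h1] := @G_bilip 0 t ltac:(lra) ltac:(lra) ltac:(lra).
  have [_ h2] := @G_bilip t 1 ltac:(lra) ltac:(lra) ltac:(lra).
  move: h1 h2; rewrite G0 G1 => h1 h2; nra.
pose phi (t : I) : I := clamp (G (val t)).
have phiE t : val (phi t) = G (val t) by rewrite clampE// G01// val01.
have phiK : bilip (2 * K) phi.
  split=> // a b ab; rewrite !phiE.
  by apply: G_bilip => //; [have := val01 a|have := val01 b]; lra.
have c0 : val (clamp (0 : R)) = 0 by rewrite clampE; lra.
have c1 : val (clamp (1 : R)) = 1 by rewrite clampE; lra.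
have [||g gE] := bilip_lip phiK.
- by apply: val_inj; rewrite phiE c0 G0.
- by apply: val_inj; rewrite phiE c1 G1.
apply/conj_lipP; exists g => t; rewrite !gE; apply: val_inj.
rewrite phiE !zigzagE phiE.
have [t1|t1] := eqVneq (val t) 1; first by rewrite t1 G1 !bump1// mul0r addr0 G1.
have [n tn] : exists n, 1 - w n <= val t < 1 - w n.+1.
  by apply: decays_itv => //; have := val01 t; rewrite lt_neqAle t1; lra.
have tn' : 1 - w n <= val t <= 1 - w n.+1 by lra.
have sn : slope n * (w n - w n.+1) = v n - v n.+1.
  by rewrite /slope divfK//; have := wgap n; have := wn0 n; lra.
have s0 := slope0 n.
have Gt := G_itv tn'; set s := slope n in sn s0 Gt.
rewrite (bump_itv dw tn') (bump_itv (n := n) dv); last by rewrite Gt; nra.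
(* Moving by half the distance to the nearer endpoint stays in the same interval, so the same affine
   formula applies. *)
rewrite (G_itv (n := n)); last by case: (leP (val t - (1 - w n))); lra.
rewrite -/s Gt.
have -> : 1 - v n.+1 - (1 - v n + s * (val t - (1 - w n))) = s * (1 - w n.+1 - val t).
  by rewrite !mulrBr; move: sn; rewrite mulrBr; lra.
have -> : 1 - v n + s * (val t - (1 - w n)) - (1 - v n) = s * (val t - (1 - w n)) by ring.
by rewrite -minr_pMr ?ltW//; ring.
Qed.

End piecewise_linear.

(** * Encoding real sequences by zigzags *)

Section ell_infty_to_lip.
Context (R : realType).
Local Notation I := (unit_itv R).
Local Notation H := (hplus R).

Definition trunc (m : nat) (r : R) : R := Num.max (- m%:R) (Num.min r m%:R).

Lemma trunc_bound m r : - m%:R <= trunc m r <= m%:R.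
Proof.
have m0 : (0 : R) <= m%:R := ler0n _ _.
by rewrite /trunc le_max lexx/= ge_max ge_min lexx orbT andbT; lra.
Qed.

Lemma trunc_dist m r s : `|trunc m r - trunc m s| <= `|r - s|.
Proof.
have m0 : (0 : R) <= m%:R := ler0n _ _.
have h (a : R) : [\/ a <= - m%:R /\ trunc m a = - m%:R,
    - m%:R <= a <= m%:R /\ trunc m a = a | m%:R <= a /\ trunc m a = m%:R].
  rewrite /trunc; case: (leP a m%:R) => am; last first.
    by rewrite max_r; [apply: Or33; rewrite ltW|lra].
  by case: (leP (- m%:R) a) => ma; [apply: Or32|apply: Or31]; rewrite ?ltW// ma.
have := ler_norm (r - s); have := ler_norm (s - r); rewrite (distrC s).
by case: (h r) => -[r1 ->]; case: (h s) => -[s1 ->]; rewrite ler_norml; lra.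
Qed.

Lemma trunc_id m r : `|r| <= m%:R -> trunc m r = r.
Proof.
rewrite ler_norml => /andP[? ?]; rewrite /trunc min_l// max_r//.
Qed.

(* logn 2 takes each value n at arbitrarily large m, so truncating at level m
   loses nothing, while it makes the increments of the exponent at least 1. *)
Definition exponent (x : real_seq R) (m : nat) : R :=
  (m * m.+1)%:R + trunc m (x (logn 2 m)).

Definition tails (x : real_seq R) (m : nat) : R := expR (- exponent x m).

Lemma tails_decay x : decays (tails x).
Proof.
split=> [|n|n]; rewrite /tails ?expR_gt0//.
  rewrite /exponent mul0n add0r /trunc oppr0.
  by case: (leP (x _) 0) => h; rewrite ?max_l ?oppr0 ?expR0// maxxx.
rewrite ler_pdivlMr//.
(* The products differ by 2n + 2 and the truncations by at most 2n + 1, so the exponent grows by at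
   least 1 and the tail shrinks by a factor of at least e >= 2. *)
have e2 : 2 <= expR (1 : R) by have := expR_ge1Dx (1 : R); lra.
apply: (@le_trans _ _ (expR (- exponent x n.+1) * expR 1)).
  by rewrite ler_wpM2l// expR_ge0.
rewrite -expRD ler_expR /exponent.
have := trunc_bound n.+1 (x (logn 2 n.+1)); have := trunc_bound n (x (logn 2 n)).
rewrite !natrM -[n.+2]addn2 -[n.+1]addn1 !natrD => ? ?.
lra.
Qed.

Lemma exponent_dist (x y : real_seq R) :
  ell_infty x y <-> exists M, forall m, `|exponent x m - exponent y m| <= M.
Proof.
rewrite ell_inftyP; split=> -[M xyM]; exists M => n.
  apply: le_trans (xyM (logn 2 n)); apply: le_trans (trunc_dist n _ _).
  by rewrite /exponent opprD addrACA subrr add0r.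
pose k := Num.bound (`|x n| + `|y n|).
(* The index m = 2^n 3^k reads coordinate n, and m >= k makes both truncations inactive. *)
have kP : `|x n| + `|y n| <= k%:R by apply/ltW/archi_boundP/addr_ge0.
pose m := (2 ^ n * 3 ^ k)%N.
have nm : logn 2 m = n.
  by rewrite /m lognM ?expn_gt0// pfactorK// lognX logn_prime// muln0 addn0.
have km : (k <= m)%N.
  by apply: leq_trans (ltnW (ltn_expl k (isT : 1 < 3)%N)) _; rewrite leq_pmull ?expn_gt0.
have mP : `|x n| + `|y n| <= m%:R by apply: le_trans kP _; rewrite ler_nat.
have := xyM m; rewrite /exponent nm !trunc_id.
- by rewrite opprD addrACA subrr add0r.
- by apply: le_trans mP; rewrite lerDr.
- by apply: le_trans mP; rewrite lerDl.
Qed.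

Definition encode (x : real_seq R) : lip R := zigzag (tails_decay x).

Lemma encode_conj x y : ell_infty x y <-> conj_lip (encode x) (encode y).
Proof.
rewrite exponent_dist; split=> [[M xyM]|xy].
  apply: (@zigzag_conj _ _ _ (expR M)) => [|n|n]; rewrite ?expR_gt0//;
    rewrite /tails -expRD ler_expR; have := xyM n; rewrite ler_norml; lra.
have [K [K0 xyK]] := zigzag_conj_le xy.
have [g gP] := (conj_lipP _ _).1 xy.
(* The comparison of tails is one-sided, so it is applied to the inverse conjugacy as well;
   logarithms then bound the exponents. *)
have [L [L0 yxL]] : exists L, 0 < L /\ forall n, tails y n <= L * tails x n.
  apply: (zigzag_conj_le (dw := tails_decay y) (dv := tails_decay x)).
  apply/conj_lipP; exists (g^-1)%g => t.
  by apply: (@hplus_inj _ g); rewrite lip_invK gP lip_invK.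
have lnle (a b C : R) : 0 < C -> expR (- a) <= C * expR (- b) -> b - a <= ln C.
  move=> C0; rewrite -{1}(lnK (x := C)) ?posrE// -expRD ler_expR; lra.
exists (Num.max (ln K) (ln L)) => m; rewrite ler_norml.
have := lnle _ _ _ K0 (xyK m); have := lnle _ _ _ L0 (yxL m).
by case: (leP (ln K) (ln L)); lra.
Qed.

Lemma trunc_continuous m : continuous (trunc m).
Proof.
move=> r; apply/cvgrPdist_lt => e e0; near=> z; apply: le_lt_trans (trunc_dist _ _ _) _.
by near: z; apply: cvgr_dist_lt.
Unshelve. all: by end_near. Qed.

Lemma tails_continuous m : continuous (fun x : real_seq R => tails x m).
Proof.
pose h (r : R) := expR (- ((m * m.+1)%:R + trunc m r)).
have ch : continuous h.
  move=> r; apply: continuous_comp; last exact: continuous_expR.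
  apply: continuousN; apply: continuousD; first exact: cvg_cst.
  exact: trunc_continuous.
move=> x; apply: (@continuous_comp (real_seq R) R R (fun y => y (logn 2 m)) h).
  exact: (@proj_continuous nat (fun=> R)).
exact: ch.
Qed.

Lemma encode_dist x y e : (forall n, `|tails x n - tails y n| <= e) ->
  sup_dist (encode x) (encode y) <= e / 2.
Proof.
move=> xye; apply: sup_dist_le => t; rewrite !zigzagE ler_norml.
have := bump_dist (tails_decay y) (val01 t) xye.
have := bump_dist (tails_decay x) (val01 t) (e := e) (w := tails y) (v := tails x).
have h n : `|tails y n - tails x n| <= e by rewrite distrC.
move=> /(_ h); lra.
Qed.

(** Pointwise convergence controls finitely many tails, and the uniform bound by powers of 1/2
    controls the others; [encode_dist] turns this into sup-distance. *)
Lemma encode_continuous : continuous (fun x : real_seq R => lip_val (encode x)).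
Proof.
move=> x B; have FF : Filter (nbhs (x : real_seq R)) := nbhs_filter x.
rewrite -nbhs_ballE => -[e /= e0 eB].
have [N Ne] := half_lt e0.
suff : \forall y \near x, forall n, `|tails x n - tails y n| <= e.
  apply: (@filterS _ _ FF) => y xy; apply: eB.
  rewrite -metricType_numDomainType.ball_mdistE /=.
  apply: le_lt_trans (encode_dist xy) _; lra.
have near_N k : \forall y \near x, forall n, (n < k)%N -> `|tails x n - tails y n| <= e.
  elim: k => [|k IH]; first by apply: (@filterE _ _ FF).
  have := proj1 (@cvgrPdist_le _ _ _ _ FF _ _) (@tails_continuous k x) e e0.
  move: IH; apply: (@filterS2 _ _ FF) => y IH ke n.
  by rewrite ltnS leq_eqVlt => /orP[/eqP->//|/IH].
have := near_N N; apply: (@filterS _ _ FF) => y xy n.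
have [nN|Nn] := ltnP n N; first exact: xy.
have small z : 0 < tails z n < e.
  rewrite expR_gt0/=; apply: le_lt_trans Ne.
  apply: le_trans (decays_homo (tails_decay z) Nn) _.
  exact: decays_le (tails_decay z).
by have := small x; have := small y; rewrite ler_norml; lra.
Qed.

Lemma measurable_encode :
  @measurable_fun _ _ (borel (real_seq R)) (borel_lip R) setT encode.
Proof.
move=> _ S [B mB <-]; rewrite !setTI.
have := @measurability _ _ (borel (real_seq R)) (borel H) setT
  (fun x => lip_val (encode x)) (@open H) erefl.
move=> /(_ _ measurableT B mB); rewrite setTI; apply.
move=> _ [W oW <-]; rewrite setTI.
apply: sub_sigma_algebra.
by apply: (open_comp (f := fun x : real_seq R => lip_val (encode x))) => // x _;
  exact: encode_continuous.
Qed.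

Lemma ell_infty_reducible_lip :
  @borel_reducible _ _ (borel (real_seq R)) (borel_lip R) (@ell_infty R) (@conj_lip R).
Proof. exists encode; split; [exact: measurable_encode|exact: encode_conj]. Qed.

End ell_infty_to_lip.

Theorem corollary3p12 (R : realType) :
  @borel_bireducible _ _ (borel_lip R) (borel (real_seq R))
    (@conj_lip R) (@ell_infty R).
Proof.
split; [exact: lip_reducible_ell_infty|exact: ell_infty_reducible_lip].
Qed.
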